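(* Let $\mathbb{F}\in\{\mathbb{R},\mathbb{C}\}$. A tensor $\mathcal{A}\in\mathbb{F}^{[n_1,\ldots,n_m]}$ is $\mathbb{F}$-separable if and only if there exists a Borel measure $\mu$ with support contained in $\mathbb{S}_{\mathbb{F}}^{n_1,\ldots,n_m}$ such that $\mathcal{A}=\int[x_1,\ldots,x_m]_{\otimes h}\,d\mu$.
   Context: $\mathbb{C}^{[n_1,\ldots,n_m]}$ is the real vector space of tensors $\mathcal{H}\in\mathbb{C}^{n_1\times\cdots\times n_m\times n_1\times\cdots\times n_m}$ with $\mathcal{H}_{i_1\ldots i_m j_1\ldots j_m}=\overline{\mathcal{H}_{j_1\ldots j_m i_1\ldots i_m}}$; $\mathbb{R}^{[n_1,\ldots,n_m]}$ is its subset of real tensors. For $v_i\in\mathbb{F}^{n_i}$, $[v_1,\ldots,v_m]_{\otimes h}:=v_1\otimes\cdots\otimes v_m\otimes\overline{v_1}\otimes\cdots\otimes\overline{v_m}$. A tensor is $\mathbb{F}$-separable if it equals $\sum_{i=1}^r[u_i^1,\ldots,u_i^m]_{\otimes h}$ for some $u_i^j\in\mathbb{F}^{n_j}$. $\mathbb{S}_{\mathbb{F}}^{n_1,\ldots,n_m}:=\{(x_1,\ldots,x_m)\in\mathbb{F}^{n_1}\times\cdots\times\mathbb{F}^{n_m}:\|x_1\|=\cdots=\|x_m\|=1\}$ (Euclidean norms). *)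

(* Defs.v *)
From HB Require Import structures.
From mathcomp Require Import all_boot all_order all_algebra.
From mathcomp Require Import all_classical all_reals all_analysis.
From mathcomp Require Import complex.
Import Order.TTheory GRing.Theory Num.Theory.
Import numFieldNormedType.Exports.
Set Implicit Arguments. Unset Strict Implicit. Unset Printing Implicit Defensive.
Local Open Scope ring_scope.
Local Open Scope classical_set_scope.

(* The ground field F ∈ {R, C}.  Everything is embedded in the complex
   numbers R[i]; F = R is encoded by requiring zero imaginary parts. *)
Inductive Fld := FR | FC.

Definition inF (R : rcfType) (F : Fld) (z : R[i]) : Prop :=
  match F with FR => complex.Im z = 0 | FC => True end.

Definition Idx (m : nat) (n : 'I_m -> nat) := forall k : 'I_m, 'I_(n k).

(* A tensor in C^{n_1 x ... x n_m x n_1 x ... x n_m}: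
   entry H i j = H_{i_1 ... i_m j_1 ... j_m}. *)
Definition tensor (R : rcfType) (m : nat) (n : 'I_m -> nat) :=
  Idx n -> Idx n -> R[i].

Definition vecfam (R : rcfType) (m : nat) (n : 'I_m -> nat) :=
  forall k : 'I_m, 'I_(n k) -> R[i].

Definition in_herm (R : rcfType) (F : Fld) (m : nat) (n : 'I_m -> nat)
  (H : tensor R n) : Prop :=
  (forall i j : Idx n, H i j = (H j i)^*%C) /\ (forall i j : Idx n, inF F (H i j)).

(* [v_1, ..., v_m]_{⊗h} = v_1 ⊗ ... ⊗ v_m ⊗ conj v_1 ⊗ ... ⊗ conj v_m *)
Definition htensor (R : rcfType) (m : nat) (n : 'I_m -> nat)
  (v : vecfam R n) : tensor R n :=
  fun i j => \prod_(k < m) (v k (i k) * (v k (j k))^*%C).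

Definition separable (R : rcfType) (F : Fld) (m : nat) (n : 'I_m -> nat)
  (A : tensor R n) : Prop :=
  exists (r : nat) (u : 'I_r -> vecfam R n),
    (forall (t : 'I_r) (k : 'I_m) (l : 'I_(n k)), inF F (u t k l)) /\
    (forall i j : Idx n, A i j = \sum_(t < r) htensor (u t) i j).

(* The ambient space C^{n_1} x ... x C^{n_m}, each complex coordinate stored
   as a pair (real part, imaginary part) in R x R, with the product topology
   (= the Euclidean topology). *)
Definition Xk (R : realType) (m : nat) (n : 'I_m -> nat) (k : 'I_m)
  : topologicalType := {ptws 'I_(n k) -> (R * R)%type}.
Definition Xsp (R : realType) (m : nat) (n : 'I_m -> nat) : topologicalType :=
  prod_topology (@Xk R m n).

Definition BorelX (R : realType) (m : nat) (n : 'I_m -> nat) :=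
  g_sigma_algebraType (@open (Xsp R n)).

Definition ptvec (R : realType) (m : nat) (n : 'I_m -> nat) (x : Xsp R n)
  : vecfam R n :=
  fun k l => ((x k l).1 +i* (x k l).2)%C.
Arguments ptvec [R m n] x k l.

Definition sphereF (R : realType) (F : Fld) (m : nat) (n : 'I_m -> nat)
  : set (Xsp R n) :=
  [set x : Xsp R n | (forall k : 'I_m, \sum_(l < n k) ((x k l).1 ^+ 2 + (x k l).2 ^+ 2) = 1)
           /\ (forall (k : 'I_m) (l : 'I_(n k)), inF F (ptvec x k l))].

Definition msupport (R : realType) (m : nat) (n : 'I_m -> nat)
  (mu : {measure set (BorelX R n) -> \bar R}) : set (Xsp R n) :=
  [set x | forall U : set (Xsp R n), open U -> U x -> (0 < mu U)%E].

Definition integral_repr (R : realType) (m : nat) (n : 'I_m -> nat)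
  (mu : {measure set (BorelX R n) -> \bar R}) (A : tensor R n) : Prop :=
  forall i j : Idx n,
    mu.-integrable setT
      (fun x : BorelX R n => (complex.Re (htensor (ptvec x) i j))%:E) /\
    mu.-integrable setT
      (fun x : BorelX R n => (complex.Im (htensor (ptvec x) i j))%:E) /\
    Rintegral mu setT (fun x : BorelX R n => complex.Re (htensor (ptvec x) i j))
      = complex.Re (A i j) /\
    Rintegral mu setT (fun x : BorelX R n => complex.Im (htensor (ptvec x) i j))
      = complex.Im (A i j).

(* Main.v *)
(* A separable tensor is the integral over the sphere of a finite sum of weighted
   Dirac masses at the normalized vectors, the weights being the products of the
   squared norms.

   Conversely, the support condition makes the sphere a set of full measure,
   because the ambient space is second countable.  An integral of a vector-valued
   function y lies in the convex cone generated by the values of y on any set of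
   full measure, with no closure: outside the cone it would be separated from it
   by a linear form, which must then vanish almost everywhere, and one concludes
   by induction on the dimension.  Since m > 0, the nonnegative coefficients are
   absorbed into the first vector through their square roots.  In particular
   neither compactness of the sphere nor Caratheodory's theorem is needed. *)
Require Import Defs.
From HB Require Import structures.
From mathcomp Require Import all_boot all_order all_algebra.
From mathcomp Require Import all_classical all_reals all_analysis.
From mathcomp Require Import complex.
From mathcomp Require Import measurable_realfun.
From mathcomp Require Import ring.
Set Implicit Arguments. Unset Strict Implicit. Unset Printing Implicit Defensive.
Import Order.TTheory GRing.Theory Num.Theory.
Import numFieldNormedType.Exports.
Local Open Scope ring_scope.
Local Open Scope classical_set_scope.

(** * Separation of a point from a convex cone in finite dimension *)

Definition convex_cone (R : realType) (d : nat) (K : set 'rV[R]_d) : Prop :=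
  [/\ K 0, forall x y, K x -> K y -> K (x + y)
    & forall c x, 0 <= c -> K x -> K (c *: x)].

(* For v outside W + Ra, every line point v + ta or its opposite lies in K, which
   cuts the line at some t0; the maximality of W at v + t0 a is contradictory. *)
Lemma convex_cone_halfspace (R : realType) (d : nat) (K : set 'rV[R]_d)
    (a : 'rV[R]_d) (W : 'M[R]_d) :
  convex_cone K -> ~ K a -> (forall w, (w <= W)%MS -> K w) ->
  (forall w, ~~ (w <= W)%MS -> forall x, exists s, K (x + s *: w)) ->
  forall v, exists s, (v - s *: a <= W)%MS.
Proof.
move=> [K0 KD KZ] Ka WK Wmax v.
have Kpos c x : 0 < c -> K (c *: x) -> K x.
  move=> c0 /(KZ c^-1); rewrite scalerA mulVf ?gt_eqF// scale1r; apply.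
  by rewrite invr_ge0 ltW.
(* The lineality space of [K] lies in [W]: if [z] and [- z] are in [K] with [z] outside [W],
   maximality gives [a + s *: z] in [K], and cancelling [s *: z] puts [a] in [K]. *)
have pointed z : K z -> K (- z) -> (z <= W)%MS.
  move=> Kz KNz; apply/negPn/negP => /Wmax /(_ a)[s Ks].
  apply: Ka; have [s0|s0] := leP 0 s.
    have := KD _ _ Ks (KZ _ _ s0 KNz).
    by congr K; apply/rowP => i; rewrite !mxE; ring.
  have := KD _ _ Ks (KZ (- s) _ _ Kz); rewrite oppr_ge0 => /(_ (ltW s0)).
  by congr K; apply/rowP => i; rewrite !mxE; ring.
apply: contrapT => /forallNP vW.
have vtW t : ~~ ((v + t *: a)%R <= W)%MS.
  by have := vW (- t); rewrite scaleNr opprK => /negP.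
have aW : ~~ (a <= W)%MS by apply/negP => /WK.
pose T := [set t : R | K (v + t *: a)].
(* Maximality at [w] towards [a] and [- a] gives [a + s *: w] and [- a + s' *: w] in [K], so
   [(s + s') *: w] is in [K]. A negative sum is the claim and a positive one puts [w] in [K]. If the
   sum is zero, [a + s *: w] and its opposite are both in [K], so it lies in [W]; dividing by [s]
   contradicts [vW]. *)
have Tneg t : ~ T t -> K (- (v + t *: a)).
  set w := v + t *: a => KNw.
  have [s Ks] := Wmax _ (vtW t) a; have [s' Ks'] := Wmax _ (vtW t) (- a).
  rewrite -/w in Ks Ks'.
  have Kss : K ((s + s') *: w).
    by have := KD _ _ Ks Ks'; congr K; apply/rowP => i; rewrite !mxE; ring.
  have [ss0|ss0|ss0] := ltgtP (s + s') 0; last 1 first.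
  - have s0 : s != 0 by apply/eqP => s0; apply: Ka; move: Ks; rewrite s0 scale0r addr0.
    exfalso; apply: (vW (- (t + s^-1))).
    have -> : v - (- (t + s^-1)) *: a = s^-1 *: (a + s *: w).
      by apply/rowP => i; rewrite !mxE; field.
    apply/scalemx_sub/pointed => //.
    move: Ks'; congr K; rewrite -[s'](addKr s) ss0.
    by apply/rowP => i; rewrite !mxE; ring.
  - apply: (Kpos (- (s + s'))); first by rewrite oppr_gt0.
    by rewrite scaleNr scalerN opprK.
  - by exfalso; apply: KNw; exact: Kpos Kss.
(* Otherwise the difference of the two line points, a positive multiple of [a], would be in [K]. *)
have Tlt t1 t2 : T t1 -> ~ T t2 -> t1 < t2.
  move=> Tt1 Tt2; rewrite ltNge; apply/negP; rewrite le_eqVlt => /predU1P[t12|t12].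
    by apply: Tt2; rewrite t12.
  apply: Ka; apply: (Kpos (t1 - t2)); first by rewrite subr_gt0.
  have := KD _ _ Tt1 (Tneg _ Tt2).
  by congr K; apply/rowP => i; rewrite !mxE; ring.
have TNK t : T t -> ~ K (- (v + t *: a)).
  by move=> Tt KN; move/negP: (vtW t); apply; exact: pointed.
have [t1 Tt1] : exists t, T t := Wmax _ aW v.
have [t2 Tt2] : exists t, ~ T t.
  have [s Ks] := Wmax _ aW (- v); exists (- s) => /TNK; apply.
  by move: Ks; congr K; apply/rowP => i; rewrite !mxE; ring.
have ubT : has_sup T.
  by split; [exists t1|exists t2 => t Tt; exact/ltW/Tlt].
have below e : 0 < e -> T (sup T - e).
  move=> e0; apply: contrapT => nT.
  have : sup T <= sup T - e.
    by apply: ge_sup => [|t Tt]; [exists t1|exact/ltW/Tlt].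
  by rewrite lerDl oppr_ge0 leNgt e0.
have above e : 0 < e -> ~ T (sup T + e).
  by move=> e0 /(ub_le_sup ubT.2); rewrite gerDl leNgt e0.
(* At the cut point, some [a + s *: w] is in [K]. If [s > 0], rescaling puts [sup T + s^-1] in [T],
   above the supremum. If [s < 0], it puts in [K] the opposite of the line point at [sup T + s^-1],
   a parameter below the supremum and hence in [T]. If [s = 0], [a] is in [K]. *)
set w := v + sup T *: a.
have [s Ks] := Wmax _ (vtW (sup T)) a; rewrite -/w in Ks.
have [s0|s0|s0] := ltgtP s 0.
- have sV : 0 < - s^-1 by rewrite oppr_gt0 invr_lt0.
  apply: (TNK _ (below _ sV)).
  have := KZ _ _ (ltW sV) Ks; congr K.
  by apply/rowP => i; rewrite !mxE; field; rewrite lt_eqF.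
- have sV : 0 < s^-1 by rewrite invr_gt0.
  apply: (above _ sV).
  have := KZ _ _ (ltW sV) Ks; congr K.
  by apply/rowP => i; rewrite !mxE; field; rewrite gt_eqF.
- by apply: Ka; move: Ks; rewrite s0 scale0r addr0.
Qed.

Lemma proper_cone_support (R : realType) (d : nat) (K : set 'rV[R]_d) :
  convex_cone K -> (exists a, ~ K a) ->
  exists2 l : 'cV[R]_d, l != 0 & forall x, K x -> 0 <= (x *m l) 0 0.
Proof.
move=> [K0 KD KZ] [a0 Ka0].
pose KW (W : 'M[R]_d) := [set x : 'rV[R]_d | exists2 w, (w <= W)%MS & K (x + w)].
(* The maximal subspace W with K + W proper turns out to be a hyperplane. *)
pose P r := `[< exists2 W : 'M[R]_d, \rank W = r & exists a, ~ KW W a >].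
have P0 : P 0%N.
  apply/asboolP; exists 0; first by rewrite mxrank0.
  by exists a0 => -[w]; rewrite submx0 => /eqP ->; rewrite addr0.
have Pd r : P r -> (r <= d)%N by move=> /asboolP[W <- _]; exact: rank_leq_row.
case: (ex_maxnP (ex_intro P 0%N P0) Pd) => r /asboolP[W rW [a KWa]] rmax.
have KWcone : convex_cone (KW W).
  split.
  - by exists 0; rewrite ?sub0mx ?addr0.
  - move=> x y [w wW Kw] [w' wW' Kw']; exists (w + w'); first exact: addmx_sub.
    by rewrite addrACA; exact: KD.
  - move=> c x c0 [w wW Kw]; exists (c *: w); first exact: scalemx_sub.
    by rewrite -scalerDr; exact: KZ.
have WKW w : (w <= W)%MS -> KW W w.
  by move=> wW; exists (- w); rewrite ?subrr// eqmx_opp.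
(* If [K + W] and the line of [w] together missed a point [x], then [W + w], of larger rank, would
   still give a proper cone. *)
have Wmax w : ~~ (w <= W)%MS -> forall x, exists s, KW W (x + s *: w).
  move=> wW x; apply: contrapT => nx.
  have /rmax : P (\rank (W + w)%MS).
    apply/asboolP; exists (W + w)%MS => //; exists x => -[y].
    move=> /sub_addsmxP[[A B] /= -> Kx]; apply: nx.
    exists (B 0 0); exists (A *m W); first exact: submxMl.
    rewrite -addrA; congr K: Kx; congr (x + _); rewrite addrC; congr (_ + _).
    by rewrite {1}[B]mx11_scalar mul_scalar_mx.
  rewrite -rW leqNgt => /negP; apply; have : (W < W + w)%MS.
    by rewrite /ltmx addsmxSl/= addsmx_sub submx_refl.
  by rewrite ltmxErank => /andP[_].
have H := convex_cone_halfspace KWcone KWa WKW Wmax.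
(* The columns of [cokermx W] are linear forms whose common zeros are exactly [W], so one of them is
   nonzero at [a]. Multiplying it by minus its value [c] at [a] fixes the sign: [l] takes the value
   [- c ^+ 2] there. *)
have : a *m cokermx W != 0.
  by rewrite -submxE; apply/negP => /WKW.
move=> /eqP/rowP/existsNP[j].
rewrite [X in _ <> X]mxE; set c := (a *m _) 0 j => /eqP c0.
pose l := - c *: col j (cokermx W).
have lW (w : 'rV[R]_d) : (w <= W)%MS -> w *m l = 0.
  by rewrite submxE => /eqP w0; rewrite -scalemxAr colE mulmxA w0 mul0mx scaler0.
have la : (a *m l) 0 0 = - c ^+ 2.
  by rewrite -scalemxAr colE mulmxA -colE mxE [col _ _ _ _]mxE -/c mulNr expr2.
exists l.
  apply/eqP => l0; move/eqP: la; rewrite l0 mulmx0 mxE eq_sym oppr_eq0 sqrf_eq0.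
  exact/negP.
(* Modulo [W], [x] equals [s *: a], so [l] has the value [- s * c ^+ 2] at [x]. If [s] were
   positive, [a] would be a positive multiple of [x] modulo [W], hence in [K + W]. *)
move=> x Kx; have [s xW] := H x; have := lW _ xW.
rewrite mulmxBl => /subr0_eq ->; rewrite -scalemxAl mxE la mulrN -mulNr.
rewrite mulr_ge0 ?sqr_ge0// oppr_ge0 leNgt; apply/negP => s0.
apply: KWa; exists (s^-1 *: (x - s *: a)); first exact: scalemx_sub.
rewrite scalerBr scalerA mulVf ?gt_eqF// scale1r addrC subrK.
by apply: KZ => //; rewrite invr_ge0 ltW.
Qed.

(** The cone [K] minus the nonnegative multiples of [a] is still proper: if it contained [a], then
    [(1 + s) *: a] would be in [K] for some [s >= 0], hence [a] too. A form that is nonnegative on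
    this larger cone is nonnegative on both [K] and [- a]. *)
Lemma convex_cone_separation (R : realType) (d : nat) (K : set 'rV[R]_d)
    (a : 'rV[R]_d) :
  convex_cone K -> ~ K a ->
  exists l : 'cV[R]_d,
    [/\ l != 0, (a *m l) 0 0 <= 0 & forall x, K x -> 0 <= (x *m l) 0 0].
Proof.
move=> [K0 KD KZ] Ka.
pose Ka' := [set x : 'rV[R]_d | exists2 s, 0 <= s & K (x + s *: a)].
have Kcone : convex_cone Ka'.
  split.
  - by exists 0 => //; rewrite scale0r addr0.
  - move=> x y [s s0 Ks] [s' s0' Ks']; exists (s + s'); first exact: addr_ge0.
    by rewrite scalerDl addrACA; exact: KD.
  - move=> c x c0 [s s0 Ks]; exists (c * s); first exact: mulr_ge0.
    by rewrite -scalerA -scalerDr; exact: KZ.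
have [|l l0 Kl] := @proper_cone_support _ _ Ka' Kcone.
  exists a => -[s s0]; rewrite -{1}[a]scale1r -scalerDl => Ks; apply: Ka.
  have s1 : 0 < 1 + s by rewrite ltr_pwDl.
  have := KZ (1 + s)^-1 _ _ Ks.
  by rewrite scalerA mulVf ?gt_eqF// scale1r; apply; rewrite invr_ge0 ltW.
exists l; split=> // [|x Kx].
- have : Ka' (- a) by exists 1 => //; rewrite scale1r addNr.
  by move=> /Kl; rewrite mulNmx mxE oppr_ge0.
- by apply: Kl; exists 0 => //; rewrite scale0r addr0.
Qed.

(** * Conic hulls and integrals of row-vector-valued functions *)

Definition conic_hull (R : realType) (T : Type) (d : nat) (y : T -> 'rV[R]_d)
    (S : set T) : set 'rV[R]_d :=
  [set v | exists r (c : 'I_r -> R) (x : 'I_r -> T),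
    [/\ forall t, 0 <= c t, forall t, S (x t) & v = \sum_t c t *: y (x t)]].

Lemma conic_hull_convex (R : realType) (T : Type) (d : nat)
    (y : T -> 'rV[R]_d) (S : set T) : convex_cone (conic_hull y S).
Proof.
split.
- exists 0%N, (fun=> 0); have x : 'I_0 -> T by case.
  by exists x; split; [|case|rewrite big_ord0].
- move=> _ _ [r [c [x [c0 Sx ->]]]] [r' [c' [x' [c0' Sx' ->]]]].
  exists (r + r')%N.
  exists (fun t => match fintype.split t with inl i => c i | inr i => c' i end).
  exists (fun t => match fintype.split t with inl i => x i | inr i => x' i end).
  split=> [t|t|]; try by case: (fintype.split t).
  have splitl i : fintype.split (lshift r' i) = inl i := unsplitK (inl i).
  have splitr i : fintype.split (rshift r i) = inr i := unsplitK (inr i).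
  rewrite big_split_ord/=; congr (_ + _); apply: eq_bigr => i _.
    by rewrite splitl.
  by rewrite splitr.
- move=> s _ s0 [r [c [x [c0 Sx ->]]]].
  exists r, (fun t => s * c t), x; split=> // [t|]; first exact: mulr_ge0.
  by rewrite scaler_sumr; apply: eq_bigr => t _; rewrite scalerA.
Qed.

Lemma subset_conic_hull (R : realType) (T : Type) (d : nat)
    (y : T -> 'rV[R]_d) (S : set T) x : S x -> conic_hull y S (y x).
Proof.
move=> Sx; exists 1%N, (fun=> 1), (fun=> x); split=> //.
by rewrite big_ord1 scale1r.
Qed.

Section RowIntegral.
Context d (T : measurableType d) (R : realType).
Variable mu : {measure set T -> \bar R}.

Definition row_integrable (k : nat) (y : T -> 'rV[R]_k) :=
  forall i, mu.-integrable setT (fun x => (y x 0 i)%:E).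

Definition row_integral (k : nat) (y : T -> 'rV[R]_k) : 'rV[R]_k :=
  \row_i Rintegral mu setT (fun x => y x 0 i).

Lemma row_integrable_mulmx (k p : nat) (y : T -> 'rV[R]_k) (B : 'M[R]_(k, p)) :
  row_integrable y -> row_integrable (fun x => y x *m B).
Proof.
move=> yi j; under eq_fun do rewrite mxE -sumEFin.
apply: integrable_sum => // i _.
by under eq_fun do rewrite mulrC EFinM; exact: integrableZl.
Qed.

(** Serves twice below: for the separating form, and for the change of coordinates onto its
    kernel. *)
Lemma row_integral_mulmx (k p : nat) (y : T -> 'rV[R]_k) (B : 'M[R]_(k, p)) :
  row_integrable y -> row_integral (fun x => y x *m B) = row_integral y *m B.
Proof.
move=> yi; apply/rowP => j; rewrite !mxE /Rintegral.
have yBi i : mu.-integrable setT (fun x => (y x 0 i * B i j)%:E).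
  by under eq_fun do rewrite mulrC EFinM; exact: integrableZl.
under eq_integral do rewrite mxE -sumEFin.
rewrite integral_sum// -sum_fine; last by move=> i _; exact: integrable_fin_num.
apply: eq_bigr => i _; rewrite mxE.
under eq_integral do rewrite EFinM.
by rewrite integralZr// fineM// integrable_fin_num.
Qed.

(** Almost everywhere [f] equals its absolute value, whose integral is therefore both nonnegative
    and nonpositive. *)
Lemma integrable_nonpos_ae_eq0 (f : T -> R) :
  mu.-integrable setT (EFin \o f) -> {ae mu, forall x, 0 <= f x} ->
  Rintegral mu setT f <= 0 ->
  Rintegral mu setT f = 0 /\ {ae mu, forall x, f x = 0}.
Proof.
move=> fi f0 If.
have mf := measurable_int _ fi.
have If' : (\int[mu]_x (EFin \o f) x = \int[mu]_x `|(EFin \o f) x|)%E.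
  apply: ae_eq_integral => //.
    exact: (measurable_int mu (integrable_abse fi)).
  by apply: filterS f0 => x fx _ /=; rewrite ger0_norm.
have If0 : (\int[mu]_x `|(EFin \o f) x| = 0)%E.
  apply/eqP; rewrite eq_le integral_ge0// andbT -If'.
  by rewrite -(fineK (integrable_fin_num _ fi))// lee_fin.
split; first by rewrite /Rintegral If' If0.
by move/ae_eq_integral_abs: If0 => /(_ measurableT mf); apply: filterS => x /(_ I)[].
Qed.

Lemma row_integral_conic_hull (k : nat) (y : T -> 'rV[R]_k) (S : set T) :
  row_integrable y -> {ae mu, forall x, S x} ->
  conic_hull y S (row_integral y).
Proof.
elim/ltn_ind: k => k IH in y S *; move=> yi Sae; set a := row_integral y.
apply: contrapT => na.
have [l [l0 al lK]] := convex_cone_separation (conic_hull_convex y S) na.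
have [al0' yl0] : Rintegral mu setT (fun x => (y x *m l) 0 0) = 0 /\
    {ae mu, forall x, (y x *m l) 0 0 = 0}.
  apply: integrable_nonpos_ae_eq0.
  - exact: row_integrable_mulmx.
  - by apply: filterS Sae => x Sx; exact/lK/subset_conic_hull.
  - by move: al; rewrite -row_integral_mulmx// mxE.
have al0 : a *m l = 0.
  by rewrite -row_integral_mulmx//; apply/rowP => i; rewrite !mxE ord1.
(* Both [a] and almost all values of [y] lie in the kernel of [l]. The rows of [B] are a basis of
   it, and [pinvmx B] reads off coordinates. Shrinking [S] to [S'] ensures that the points returned
   by the induction hypothesis have values in the kernel, so that [B] recovers them. *)
pose B := row_base (kermx l); pose S' := S `&` [set x | y x *m l = 0].
have BP (v : 'rV[R]_k) : v *m l = 0 -> v *m pinvmx B *m B = v.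
  by move=> vl; rewrite mulmxKpV// eq_row_base; exact/sub_kermxP.
(* A nonzero [l] forces [k > 0], so dimension zero is covered without a base case. *)
have rk : (\rank (kermx l) < k)%N.
  have l1 : (0 < \rank l)%N by rewrite lt0n mxrank_eq0.
  by rewrite mxrank_ker ltn_subrL l1 (leq_trans l1 (rank_leq_row l)).
have S'ae : {ae mu, forall x, S' x}.
  apply: filterS2 Sae yl0 => x Sx yx; split=> //=.
  by apply/rowP => i; rewrite ord1 yx mxE.
have [r [c [x [c0 Sx Ex]]]] := IH _ rk _ S' (row_integrable_mulmx (pinvmx B) yi) S'ae.
apply: na; exists r, c, x; split=> // [t|]; first by case: (Sx t).
rewrite -(BP _ al0) -row_integral_mulmx// Ex mulmx_suml.
by apply: eq_bigr => t _; rewrite -scalemxAl BP//; case: (Sx t).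
Qed.

End RowIntegral.

(** * Second countability of the ambient space, null sets and Borel measurability *)

Lemma cvg_prod_topology (I : Type) (K : I -> topologicalType)
    (F : set_system (prod_topology K)) (x : prod_topology K) :
  Filter F -> (forall i, (fun f : prod_topology K => f i) @ F --> x i) -> F --> x.
Proof.
move=> FF Fx; apply/cvg_sup => i A [V [[C oC <-] Cx]] VA.
by apply: (filterS VA); apply: (Fx i); exact: open_nbhs_nbhs.
Qed.

(** The second hypothesis says, in terms of filters, that the [g i] determine the topology. The base
    consists of finite intersections of preimages of intervals with rational endpoints. *)
Lemma second_countable_of_coordinates (R : realType) (X : topologicalType)
    (I : countType) (g : I -> X -> R) :
  (forall i, continuous (g i)) ->
  (forall (F : set_system X) x, Filter F ->
    (forall i, g i @ F --> g i x) -> F --> x) ->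
  @second_countable X.
Proof.
move=> gc gcvg.
pose V (p : I * rat * rat) : set X := g p.1.1 @^-1` `]ratr p.1.2, ratr p.2[%classic.
pose D := range V; pose B := finI_from D id.
have Bo : B `<=` open.
  move=> _ [J JD <-]; rewrite bigcap_fset big_seq.
  elim/big_ind: _ => [||U /JD]; [exact: openT|exact: openI|].
  rewrite inE => -[p _ <-]; apply: open_comp; last exact: itv_open.
  by move=> x _; exact: gc.
exists B.
  apply: finI_from_countable; apply: sub_countable (card_image_le _ _) _.
  exact: countableP.
split=> // x; apply: gcvg.
  apply: filter_from_filter.
    have [U BU Ux] : (\bigcup_(U in B) U) x by rewrite finI_from_cover.
    by exists U.
  move=> U U' [BU Ux] [BU' Ux']; exists (U `&` U') => //.
  by split=> //; exact: finI_fromI.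
move=> i A /nbhs_ballP[e /= e0 eA].
have [|q1 q1P] := @rat_in_itvoo R (g i x - e) (g i x); first by rewrite ltrBlDr ltrDl.
have [|q2 q2P] := @rat_in_itvoo R (g i x) (g i x + e); first by rewrite ltrDl.
move: q1P q2P; rewrite !in_itv/= => /andP[q11 q12] /andP[q21 q22].
exists (V (i, q1, q2)).
  split; last by rewrite /V /= in_itv/= q12 q21.
  by apply: finI_from1; exists (i, q1, q2).
move=> y; rewrite /V /= in_itv/= => /andP[y1 y2]; apply: eA.
rewrite /ball/= ltr_distlC; apply/andP; split.
  exact: lt_trans y1.
exact: lt_trans q22.
Qed.

Section Xsp.
Variables (R : realType) (m : nat) (n : 'I_m -> nat).

Lemma continuous_coordinate1 k l : continuous (fun x : Xsp R n => (x k l).1 : R).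
Proof.
move=> x.
apply: (@continuous_comp _ _ _ (fun x : Xsp R n => x k : Xk R n k) (fun z => (z l).1)).
  exact: (@proj_continuous _ (@Xk R m n) k).
apply: (@continuous_comp _ _ _ (fun z : Xk R n k => z l : (R * R)%type) fst).
  exact: (@proj_continuous _ (fun=> (R * R)%type) l).
exact: cvg_fst.
Qed.

Lemma continuous_coordinate2 k l : continuous (fun x : Xsp R n => (x k l).2 : R).
Proof.
move=> x.
apply: (@continuous_comp _ _ _ (fun x : Xsp R n => x k : Xk R n k) (fun z => (z l).2)).
  exact: (@proj_continuous _ (@Xk R m n) k).
apply: (@continuous_comp _ _ _ (fun z : Xk R n k => z l : (R * R)%type) snd).
  exact: (@proj_continuous _ (fun=> (R * R)%type) l).
exact: cvg_snd.
Qed.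

Lemma Xsp_second_countable : @second_countable (Xsp R n).
Proof.
pose g (i : {k : 'I_m & 'I_(n k)} + {k : 'I_m & 'I_(n k)}) (x : Xsp R n) : R :=
  match i with inl p => (x (tag p) (tagged p)).1
             | inr p => (x (tag p) (tagged p)).2 end.
apply: (@second_countable_of_coordinates R _ _ g).
  by move=> [p|p]; [exact: continuous_coordinate1|exact: continuous_coordinate2].
move=> F x FF Fg; apply: cvg_prod_topology => k; apply: cvg_prod_topology => l.
have H1 := Fg (inl (Tagged (fun k => 'I_(n k)) l)).
have H2 := Fg (inr (Tagged (fun k => 'I_(n k)) l)).
move=> A [[P Q] /= [xP xQ] PQA].
have FP : F [set z | P (z k l).1] := H1 _ xP.
have FQ : F [set z | Q (z k l).2] := H2 _ xQ.
suff : F [set z | A (z k l)] by [].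
by apply: filterS2 FP FQ => z Pz Qz; exact: PQA.
Qed.

(** A Lindelöf argument: every point outside [S] lies in a basic open set of measure zero, and there
    are countably many of these. *)
Lemma ae_of_locally_null (mu : {measure set (BorelX R n) -> \bar R})
    (S : set (Xsp R n)) :
  (forall x, ~ S x -> exists U : set (Xsp R n), [/\ open U, U x & mu U = 0%E]) ->
  {ae mu, forall x, S x}.
Proof.
have [B /countable_injP[f finj] [Bo Bx]] := Xsp_second_countable; move=> H.
(* As [f] is injective, [N k] is the null basic set with code [k], or empty if there is none; this
   enumerates the null basic sets by [nat]. *)
pose N (k : nat) : set (Xsp R n) := \bigcup_(U in [set U | [/\ B U, f U = k & mu U = 0%E]]) U.
have N0 k : mu.-negligible (N k).
  have [[U [BU fU mU]]|nU] := pselect (exists U, [/\ B U, f U = k & mu U = 0%E]).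
    exists U; split=> //; first by apply: sub_sigma_algebra; exact: Bo.
    move=> x [U' [BU' fU' _] U'x].
    by rewrite (finj U U') ?inE// fU fU'.
  by exists set0; split=> // x [U HU]; exfalso; apply: nU; exists U.
apply: negligibleS (negligible_bigcup N0) => x /= Sx.
have [U [oU Ux U0]] := H x Sx.
have [V [BV Vx] VU] : filter_from [set U | B U /\ U x] id U.
  by apply: Bx; exact: open_nbhs_nbhs.
exists (f V) => //; exists V => //; split=> //.
apply/eqP; rewrite -measure_le0 -U0; apply: le_measure => //; rewrite inE.
- by apply: sub_sigma_algebra; exact: Bo.
- by apply: sub_sigma_algebra.
Qed.

Lemma continuous_measurable_borel (f : Xsp R n -> R) :
  continuous f ->
  measurable_fun setT (f : BorelX R n -> R).
Proof.
move=> cf; apply: (measurability _ (RGenOpens.measurableE R)) => _ [_ [a [b ->]] <-].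
rewrite setTI; apply: sub_sigma_algebra; apply: open_comp => [x _|].
  exact: cf.
exact: itv_open.
Qed.

End Xsp.

(** * Finite sums of weighted Dirac masses *)

Section WeightedDiracs.
Context d (T : measurableType d) (R : realType).
Variables (r : nat) (c : 'I_r -> {nonneg R}) (a : 'I_r -> T).

(** [msum] expects a sequence of measures indexed by [nat], so the family is padded with the zero
    measure from [r] on. *)
Definition atom (t : nat) : {measure set T -> \bar R} :=
  if insub t is Some o then mscale (c o) (dirac (a o)) else mzero.

Definition atomic_measure : {measure set T -> \bar R} := msum atom r.

Lemma atomic_measureE (U : set T) :
  atomic_measure U = (\sum_t (c t)%:num%:E * \d_(a t) U)%E.
Proof.
rewrite /atomic_measure/= /msum; apply: eq_bigr => t _.
by rewrite /atom valK.
Qed.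

Lemma integral_atomic_measure (f : T -> R) :
  measurable_fun setT f -> (forall x, 0 <= f x) ->
  (\int[atomic_measure]_x (f x)%:E = (\sum_t (c t)%:num * f (a t))%:E)%E.
Proof.
move=> mf f0.
have mEf : measurable_fun setT (EFin \o f) by exact/measurable_EFinP.
rewrite ge0_integral_measure_sum//; last by move=> x _; rewrite lee_fin.
rewrite -sumEFin; apply: eq_bigr => t _.
rewrite /atom valK ge0_integral_mscale//; last by move=> x _; rewrite lee_fin.
by rewrite integral_dirac// diracT mul1e.
Qed.

Lemma integrable_atomic_measure (f : T -> R) :
  measurable_fun setT f -> atomic_measure.-integrable setT (EFin \o f).
Proof.
move=> mf; apply/integrableP; split; first exact/measurable_EFinP.
by rewrite (integral_atomic_measure (f := fun x => `|f x|)) ?ltry//; exact: measurableT_comp.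
Qed.

Lemma Rintegral_atomic_measure (f : T -> R) :
  measurable_fun setT f ->
  Rintegral atomic_measure setT f = \sum_t (c t)%:num * f (a t).
Proof.
move=> mf; rewrite /Rintegral integralE.
rewrite -[X in X^\+%E]/(EFin \o f) -[X in X^\-%E]/(EFin \o f) funerpos funerneg.
rewrite !integral_atomic_measure//; last 2 first.
- exact: measurable_funrneg.
- exact: measurable_funrpos.
rewrite -EFinB/= -sumrB; apply: eq_bigr => t _; rewrite -mulrBr; congr (_ * _).
exact: (congr1 (fun g : T -> R => g (a t)) (funrposBneg f)).
Qed.

End WeightedDiracs.

(** * Real and imaginary parts *)

Section Complex.
Variable R : rcfType.
Implicit Types z w : R[i].

Lemma ReM z w :
  complex.Re (z * w) = complex.Re z * complex.Re w - complex.Im z * complex.Im w.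
Proof. by case: z w => [a b] [c d]. Qed.

Lemma ImM z w :
  complex.Im (z * w) = complex.Re z * complex.Im w + complex.Im z * complex.Re w.
Proof. by case: z w => [a b] [c d]. Qed.

Lemma ReMr (c : R) z : complex.Re (c%:C%C * z) = c * complex.Re z.
Proof. by rewrite ReM/= mul0r subr0. Qed.

Lemma ImMr (c : R) z : complex.Im (c%:C%C * z) = c * complex.Im z.
Proof. by rewrite ImM/= mul0r addr0. Qed.

Lemma Re_sum (I : finType) (f : I -> R[i]) :
  complex.Re (\sum_i f i) = \sum_i complex.Re (f i).
Proof. by apply: (big_morph (@complex.Re R)) => // -[a b] [c d]. Qed.

Lemma Im_sum (I : finType) (f : I -> R[i]) :
  complex.Im (\sum_i f i) = \sum_i complex.Im (f i).
Proof. by apply: (big_morph (@complex.Im R)) => // -[a b] [c d]. Qed.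

Lemma complex_ext z w :
  complex.Re z = complex.Re w -> complex.Im z = complex.Im w -> z = w.
Proof. by case: z w => [a b] [c d]/= -> ->. Qed.

Lemma inF_scale F (c : R) z : inF F z -> inF F (c%:C%C * z).
Proof. by case: F => //=; rewrite /inF ImMr => ->; rewrite mulr0. Qed.

Lemma mulcJ_scale (c : R) z w :
  (c%:C * z * (c%:C * w)^* = (c ^+ 2)%:C * (z * w^*))%C.
Proof. by case: z w => [z1 z2] [w1 w2]; apply: complex_ext => /=; ring. Qed.

End Complex.

(** * The product of spheres and the integrands on the ambient space *)

Section Sphere.
Variables (R : realType) (F : Fld) (m : nat) (n : 'I_m -> nat).

(** Makes the complement of the sphere an open set on which the support condition can be tested. The
    sphere is cut out by equations between continuous functions. *)
Lemma closed_sphereF : closed (@sphereF R F m n).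
Proof.
have sq (f : Xsp R n -> R) : continuous f -> continuous (fun x => f x ^+ 2).
  by move=> fc x; exact: continuous_comp (fc x) (@exprn_continuous R 2 _).
have -> : @sphereF R F m n =
    \bigcap_k [set x : Xsp R n | \sum_(l < n k) ((x k l).1 ^+ 2 + (x k l).2 ^+ 2) = 1] `&`
    \bigcap_k \bigcap_l [set x : Xsp R n | inF F (ptvec x k l)].
  apply/seteqP; split=> x /= [h1 h2]; split=> [k|k].
  - by move=> _; exact: h1.
  - by move=> _ l _; exact: h2.
  - exact: h1.
  - by move=> l; exact: h2.
apply: closedI; apply: closed_bigI => k _.
  apply: (@preimage_closed _ _ (fun x : Xsp R n =>
    \sum_(l < n k) ((x k l).1 ^+ 2 + (x k l).2 ^+ 2)) [set 1]); last exact: closed_eq.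
  move=> x _; apply: continuous_big x => [|l _ x]; first exact: add_continuous.
  exact: cvgD (sq _ (@continuous_coordinate1 R m n k l) x)
              (sq _ (@continuous_coordinate2 R m n k l) x).
apply: closed_bigI => l _; case: F => /=; last exact: closedT.
apply: (@preimage_closed _ _ (fun x : Xsp R n => (x k l).2 : R) [set 0]); last exact: closed_eq.
by move=> x _; exact: continuous_coordinate2.
Qed.

Lemma measurable_htensor (i j : Idx n) :
  measurable_fun setT (fun x : BorelX R n => complex.Re (htensor (ptvec x) i j)) /\
  measurable_fun setT (fun x : BorelX R n => complex.Im (htensor (ptvec x) i j)).
Proof.
(* Measurability of both parts at once is stable under products and conjugation, so it passes from
   the coordinates to the product defining [htensor], by induction on the list of factors. *)
pose M (f : BorelX R n -> R[i]) :=
  measurable_fun setT (fun x => complex.Re (f x)) /\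
  measurable_fun setT (fun x => complex.Im (f x)).
have MM f g : M f -> M g -> M (fun x => f x * g x).
  move=> [rf If] [rg Ig]; split.
  - apply: (eq_measurable_fun (fun x => complex.Re (f x) * complex.Re (g x) -
      complex.Im (f x) * complex.Im (g x))); first by move=> x _; rewrite ReM.
    by apply: measurable_funB; exact: measurable_funM.
  - apply: (eq_measurable_fun (fun x => complex.Re (f x) * complex.Im (g x) +
      complex.Im (f x) * complex.Re (g x))); first by move=> x _; rewrite ImM.
    by apply: measurable_funD; exact: measurable_funM.
have Mc k l : M (fun x => ptvec x k l).
  split; apply: continuous_measurable_borel.
  - exact: continuous_coordinate1.
  - exact: continuous_coordinate2.
have MJ f : M f -> M (fun x => (f x)^*%C).
  move=> [rf If]; split.
  - by apply: eq_measurable_fun rf => x _; case: (f x).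
  - apply: (eq_measurable_fun (fun x => - complex.Im (f x))).
      by move=> x _; case: (f x).
    exact: measurable_funN.
suff H (s : seq 'I_m) :
    M (fun x => \prod_(k <- s) (ptvec x k (i k) * (ptvec x k (j k))^*%C)) by exact: H.
elim: s => [|k s [IH1 IH2]].
  split.
  - by apply: (eq_measurable_fun (cst 1 : BorelX R n -> R)) => // x _; rewrite big_nil.
  - by apply: (eq_measurable_fun (cst 0 : BorelX R n -> R)) => // x _; rewrite big_nil.
have [H1 H2] := MM _ _ (MM _ _ (Mc k (i k)) (MJ _ (Mc k (j k)))) (conj IH1 IH2).
by split; [apply: eq_measurable_fun H1|apply: eq_measurable_fun H2] => x _; rewrite big_cons.
Qed.

(** A point outside the support has, by definition, an open neighbourhood of measure zero. *)
Lemma ae_sphereF (mu : {measure set (BorelX R n) -> \bar R}) :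
  msupport mu `<=` @sphereF R F m n -> {ae mu, forall x, @sphereF R F m n x}.
Proof.
move=> supp; apply: ae_of_locally_null => x /(contra_not (supp x)).
move=> /existsNP[U /not_implyP[oU /not_implyP[Ux U0]]]; exists U; split=> //.
by apply/eqP; move/negP: U0; rewrite lt0e measure_ge0 andbT negbK.
Qed.

End Sphere.

(** * The two directions of the equivalence *)

Section Separability.
Variables (R : realType) (F : Fld) (m : nat) (n : 'I_m -> nat).

Lemma separable_conic (A : tensor R n) (r : nat) (c : 'I_r -> R)
    (u : 'I_r -> vecfam R n) :
  (0 < m)%N -> (forall t, 0 <= c t) -> (forall t k l, inF F (u t k l)) ->
  (forall i j, A i j = \sum_t (c t)%:C%C * htensor (u t) i j) ->
  separable F A.
Proof.
move=> m0 c0 uF AE; pose k0 := Ordinal m0.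
(* [htensor] is quadratic in each vector, so scaling the vector at [k0] alone by the square root of
   [c t] produces the factor [c t]. *)
exists r, (fun t k l => (if k == k0 then Num.sqrt (c t) else 1)%:C%C * u t k l).
split=> [t k l|i j]; first exact: inF_scale.
rewrite AE; apply: eq_bigr => t _; rewrite /htensor.
under [RHS]eq_bigr do rewrite mulcJ_scale.
rewrite [RHS]big_split/=; congr (_ * _).
rewrite (bigD1 k0)//= sqr_sqrtr// big1 ?mulr1// => k /negbTE ->.
by rewrite expr1n.
Qed.

Lemma separable_of_integral_repr (A : tensor R n)
    (mu : {measure set (BorelX R n) -> \bar R}) :
  (0 < m)%N -> msupport mu `<=` @sphereF R F m n -> integral_repr mu A ->
  separable F A.
Proof.
move=> m0 supp Amu.
(* Multi-indices are taken as finite functions, which form a finite type; the real and imaginary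
   parts of all entries then form one real row vector [y]. *)
pose J := {dffun forall k : 'I_m, 'I_(n k)}.
pose part (b : bool) : R[i] -> R := if b then @complex.Re R else @complex.Im R.
pose entry (x : BorelX R n) (p : J * J * bool) : R :=
  part p.2 (htensor (ptvec x) p.1.1 p.1.2).
pose y (x : BorelX R n) : 'rV[R]_#|{: J * J * bool}| :=
  \row_q entry x (enum_val q).
have yE x q : y x 0 q = entry x (enum_val q) by rewrite mxE.
have yi : row_integrable mu y.
  move=> q; have -> : (fun x => (y x 0 q)%:E) = (fun x => (entry x (enum_val q))%:E).
    by apply/funext => x; rewrite yE.
  case: (enum_val q) => -[i j] b; have [ReI [ImI _]] := Amu i j.
  by case: b.
have [r [c [x [c0 Sx Ex]]]] := row_integral_conic_hull yi (ae_sphereF supp).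
have partA b i j : part b (A i j) = \sum_t c t * part b (htensor (ptvec (x t)) i j).
  pose p : J * J * bool := (finfun i, finfun j, b).
  have iE : (finfun i : J) = i :> Idx n by apply: functional_extensionality_dep => k; rewrite ffunE.
  have jE : (finfun j : J) = j :> Idx n by apply: functional_extensionality_dep => k; rewrite ffunE.
  have := congr1 (fun v : 'rV_ _ => v 0 (enum_rank p)) Ex.
  rewrite mxE summxE => H.
  transitivity (Rintegral mu setT (fun x => y x 0 (enum_rank p))).
    have [_ [_ [ReA ImA]]] := Amu i j.
    transitivity (Rintegral mu setT (fun x : BorelX R n => part b (htensor (ptvec x) i j))).
      by case: (b).
    by apply: eq_Rintegral => z _; rewrite yE enum_rankK /entry/= iE jE.
  rewrite H; apply: eq_bigr => t _.
  by rewrite mxE yE enum_rankK /entry/= iE jE.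
apply: (@separable_conic A r c (fun t => ptvec (x t))) => // [t k l|i j].
  by have [_] := Sx t; apply.
apply: complex_ext.
- by rewrite Re_sum; apply: etrans (partA true i j) _; apply: eq_bigr => t _; rewrite ReMr.
- by rewrite Im_sum; apply: etrans (partA false i j) _; apply: eq_bigr => t _; rewrite ImMr.
Qed.

Definition sqnorm (u : vecfam R n) (k : 'I_m) : R :=
  \sum_(l < n k) (complex.Re (u k l) ^+ 2 + complex.Im (u k l) ^+ 2).

Lemma sqnorm_ge0 u k : 0 <= sqnorm u k.
Proof. by apply: sumr_ge0 => l _; rewrite addr_ge0// sqr_ge0. Qed.

Lemma sqnorm_eq0 u k l : sqnorm u k = 0 -> u k l = 0.
Proof.
move/eqP; rewrite psumr_eq0; last by move=> i _; rewrite addr_ge0// sqr_ge0.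
move=> /allP/(_ l); rewrite mem_index_enum => /(_ isT)/=.
rewrite paddr_eq0 ?sqr_ge0// !sqrf_eq0 => /andP[/eqP Re0 /eqP Im0].
exact: complex_ext.
Qed.

(* A zero component stays zero, since 0^-1 = 0. *)
Definition normalize (u : vecfam R n) : Xsp R n := fun k l =>
  ((Num.sqrt (sqnorm u k))^-1 * complex.Re (u k l),
   (Num.sqrt (sqnorm u k))^-1 * complex.Im (u k l)).

Lemma ptvec_normalize u k l :
  ptvec (normalize u) k l = ((Num.sqrt (sqnorm u k))^-1)%:C%C * u k l.
Proof. by apply: complex_ext; rewrite ?ReMr ?ImMr. Qed.

Lemma htensor_normalize u i j :
  htensor u i j =
  (\prod_k sqnorm u k)%:C%C * htensor (ptvec (normalize u)) i j.
Proof.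
rewrite rmorph_prod -big_split; apply: eq_bigr => k _.
suff -> : u k (i k) * (u k (j k))^*%C = (sqnorm u k)%:C%C *
    (ptvec (normalize u) k (i k) * (ptvec (normalize u) k (j k))^*%C) by [].
rewrite !ptvec_normalize mulcJ_scale.
(* If a component vanishes, its factor is zero on both sides. *)
have [u0|u0] := eqVneq (sqnorm u k) 0.
  by rewrite (sqnorm_eq0 (i k) u0) mul0r !mulr0.
apply: complex_ext; rewrite ?ReMr ?ImMr mulrA exprVn sqr_sqrtr ?sqnorm_ge0//;
  by rewrite mulfV// mul1r.
Qed.

Lemma sphereF_normalize u :
  (forall k l, inF F (u k l)) -> (forall k, sqnorm u k != 0) ->
  @sphereF R F m n (normalize u).
Proof.
move=> uF u0; split=> [k|k l]; last by rewrite ptvec_normalize; exact: inF_scale.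
transitivity ((sqnorm u k)^-1 * sqnorm u k); last by rewrite mulVf.
rewrite {2}/sqnorm mulr_sumr; apply: eq_bigr => l _.
by rewrite /= !exprMn -mulrDr exprVn sqr_sqrtr ?sqnorm_ge0.
Qed.

Lemma integral_repr_of_separable (A : tensor R n) :
  separable F A ->
  exists mu : {measure set (BorelX R n) -> \bar R},
    msupport mu `<=` @sphereF R F m n /\ integral_repr mu A.
Proof.
move=> [r [u [uF AE]]].
have c0 t : 0 <= \prod_k sqnorm (u t) k by apply: prodr_ge0 => k _; exact: sqnorm_ge0.
pose c t := NngNum (c0 t).
pose x t : BorelX R n := normalize (u t).
exists (atomic_measure c x); split.
  (* A support point off the sphere would give positive measure to the open complement of the
     sphere. Each term there is zero: either some component of [u t] vanishes and so does the
     weight, or the atom lies on the sphere. *)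
  move=> z zsupp; apply: contrapT => zS.
  have oS := closed_openC (@closed_sphereF R F m n).
  have := zsupp _ oS zS; rewrite atomic_measureE big1 ?ltxx// => t _.
  have [/existsP[k /eqP k0]|/existsPn u0] := boolP [exists k, sqnorm (u t) k == 0].
    by rewrite /= (bigD1 k)//= k0 mul0r mul0e.
  rewrite diracE memNset ?mule0// => /=; apply; exact: sphereF_normalize.
move=> i j; have [mRe mIm] := @measurable_htensor R m n i j.
split; first exact: integrable_atomic_measure.
split; first exact: integrable_atomic_measure.
split; rewrite Rintegral_atomic_measure// AE.
- by rewrite Re_sum; apply: eq_bigr => t _; rewrite (htensor_normalize (u t)) ReMr.
- by rewrite Im_sum; apply: eq_bigr => t _; rewrite (htensor_normalize (u t)) ImMr.
Qed.

End Separability.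

Unset Implicit Arguments.

Theorem theorem6p4 (R : realType) (F : Fld) (m : nat) (n : 'I_m -> nat)
  (Hm : (0 < m)%N) (A : tensor R n) (HA : in_herm F A) :
  separable F A <->
  exists mu : {measure set (BorelX R n) -> \bar R},
    msupport mu `<=` @sphereF R F m n /\ integral_repr mu A.
Proof.
split; first exact: integral_repr_of_separable.
by move=> [mu [supp Amu]]; exact: separable_of_integral_repr Amu.
Qed.
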